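(* Let $X$ be a Banach space and $T\in\mathcal B(X)$. Assume that the analytic core $K(T)$ is closed and hyperinvariantly complemented with complement $N$ (i.e. $N$ is a closed subspace, hyperinvariant for $T$, with $X=K(T)\oplus N$), and that $N(T)\cap K(T)=\{0\}$, where $N(T)$ is the kernel of $T$. Then $T$ is naturally invertible (in the algebra $\mathcal B(X)$), and the greatest element of $\Sigma_2(T)$ is the projection onto $K(T)$ parallel to $N$.
   Context: $\mathcal B(X)$ is the algebra of bounded linear operators on $X$. A subspace is hyperinvariant for $T$ if it is invariant under every bounded operator commuting with $T$. The analytic core $K(T)$ is the set of all $x_0\in X$ for which there exist a sequence $(x_n)_{n\ge 1}$ in $X$ and $c>0$ such that $Tx_n=x_{n-1}$ and $\|x_n\|\le c^n\|x_0\|$ for all $n\ge1$. For $A\subseteq\mathcal B(X)$, $A'$ is its commutant in $\mathcal B(X)$ and $A''=(A')'$. Idempotents of $\mathcal B(X)$ are ordered by $P\le Q\iff PQ=QP=P$ (natural partial order). Green's relations are those of the multiplicative monoid $\mathcal B(X)$: $U\leq_{\mathcal L}V\iff U\in\mathcal B(X)V$; $U\leq_{\mathcal R}V\iff U\in V\mathcal B(X)$; $U\leq_{\mathcal H}V$ iff both hold; $U\,\mathcal H\,V$ iff $U\leq_{\mathcal H}V$ and $V\leq_{\mathcal H}U$. $\Sigma_2(T)=\{P\in\mathcal B(X): P^2=P,\ PTP\,\mathcal H\,P,\ P\in\{T\}''\}$. $T$ is naturally invertible if $\Sigma_2(T)$ has a greatest element for the natural partial order. *)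

(* Defs.v *)
From HB Require Import structures.
From mathcomp Require Import all_boot all_order all_algebra.
From mathcomp Require Import all_classical all_reals all_analysis.
From mathcomp Require Import complex.

Set Implicit Arguments.
Unset Strict Implicit.
Unset Printing Implicit Defensive.

Import Order.TTheory GRing.Theory Num.Theory.
Import numFieldNormedType.Exports.

Local Open Scope classical_set_scope.
Local Open Scope ring_scope.

(* The scalars of a Banach space: [completeNormedModType K] makes sense over
   any [numFieldType] K, e.g. over [rat], so we require K to be the field of
   real or of complex numbers.  For K = R[i] the norm takes its values in
   R[i]; there [0 < c] and [x <= y] imply that c, resp. y - x, is real. *)
Inductive real_or_complex : numFieldType -> Prop :=
| RealScalars (R : realType) : real_or_complex R
| ComplexScalars (R : realType) : real_or_complex R[i].

Section Operators.
Context {K : numFieldType} {X : completeNormedModType K}.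

(* Operators are plain functions, so that the product and the unit of the
   monoid B(X) are [\o] and [idfun]; B(X) is the set [bounded_op]. *)
Definition bounded_op : set (X -> X) :=
  [set T | linear T /\ exists M : K, forall x, `|T x| <= M * `|x|].

Definition commutant (A : set (X -> X)) : set (X -> X) :=
  [set S | bounded_op S /\ forall U, A U -> S \o U = U \o S].

Definition bicommutant (A : set (X -> X)) : set (X -> X) :=
  commutant (commutant A).

Definition green_leL (U V : X -> X) := exists2 W, bounded_op W & U = W \o V.

Definition green_leR (U V : X -> X) := exists2 W, bounded_op W & U = V \o W.

Definition green_leH (U V : X -> X) := green_leL U V /\ green_leR U V.

Definition green_H (U V : X -> X) := green_leH U V /\ green_leH V U.

Definition natural_le (P Q : X -> X) := P \o Q = P /\ Q \o P = P.

Definition natural_greatest (A : set (X -> X)) (P : X -> X) :=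
  A P /\ forall Q, A Q -> natural_le Q P.

Definition Sigma2 (T : X -> X) : set (X -> X) :=
  [set P | [/\ bounded_op P, P \o P = P, green_H (P \o T \o P) P &
               bicommutant [set T] P]].

Definition naturally_invertible (T : X -> X) :=
  exists P, natural_greatest (Sigma2 T) P.

Definition linear_subspace (M : set X) :=
  M 0 /\ forall (a : K) x y, M x -> M y -> M (a *: x + y).

Definition hyperinvariant (T : X -> X) (M : set X) :=
  forall S, bounded_op S -> S \o T = T \o S -> S @` M `<=` M.

Definition op_kernel (T : X -> X) : set X := [set x | T x = 0].

Definition analytic_core (T : X -> X) : set X :=
  [set x0 | exists (x : nat -> X) (c : K),
    [/\ x 0%N = x0, 0 < c &
        forall n, (1 <= n)%N ->
          T (x n) = x n.-1 /\ `|x n| <= c ^+ n * `|x0|]].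

Definition direct_sum (M N : set X) :=
  (forall x, exists m n, [/\ M m, N n & x = m + n]) /\ M `&` N = [set 0].

Definition projection_onto_parallel (M N : set X) (P : X -> X) :=
  forall m n, M m -> N n -> P (m + n) = m.

End Operators.

(* Main.v *)
Require Import Defs.
From HB Require Import structures.
From mathcomp Require Import all_boot all_order all_algebra.
From mathcomp Require Import all_classical all_reals all_analysis.
From mathcomp Require Import complex.
From mathcomp Require Import ring.

Set Implicit Arguments.
Unset Strict Implicit.
Unset Printing Implicit Defensive.

Import Order.TTheory GRing.Theory Num.Theory.
Import numFieldNormedType.Exports.

Local Open Scope classical_set_scope.
Local Open Scope ring_scope.

(** The analytic core is a hyperinvariant linear subspace on which T is onto,
    and T is one-to-one on it by hypothesis. The closed graph theorem makes the
    projection P onto K(T) along N and the inverse W of T on K(T), composed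
    with P, bounded; hence P T P and P are H-related through W, and P lies in
    the bicommutant because both summands are hyperinvariant. Conversely, if Q
    is in Sigma_2(T) and Q = Q T Q S, then T (Q S) is the identity on the range
    of Q, so iterating Q S gives backward orbits of geometric growth: the range
    of Q lies in K(T), that is P Q = Q, and Q P = P Q since P commutes
    with T. *)

(** In [R[i]], [0 <= x] forces a zero imaginary part, so the complex case falls back on the real
    one. *)
Lemma real_or_complex_archimedean (K : numFieldType) :
  real_or_complex K -> forall x : K, 0 <= x -> exists n : nat, x <= n%:R.
Proof.
case=> R.
  move=> x x0; exists (Num.truncn x).+1.
  by apply: ltW; exact: truncnS_gt.
case=> a b; rewrite lecE /= => /andP[/eqP -> a0].
exists (Num.truncn a).+1.
rewrite -(rmorph_nat (real_complex R)) lecE /= eqxx /=.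
by apply: ltW; exact: truncnS_gt.
Qed.

(** * Sequences controlled by halving radii *)

Section Halving.
Context {K : numFieldType}.
Variables (hK : real_or_complex K) (r : nat -> K).
Hypotheses (r_ge0 : forall n, 0 <= r n)
  (r_half : forall n, r n.+1 <= r n / 2).

Lemma halving_small (e : K) :
  0 < e -> exists n, forall m, (n <= m)%N -> r m < e.
Proof.
move=> e0.
have re0 : 0 <= r 0%N / e by rewrite divr_ge0// ltW.
have [n] := real_or_complex_archimedean hK re0.
rewrite ler_pdivrMr// => rn; exists n => m nm.
have rm : r m * 2 ^+ m <= r 0%N.
  elim: m {nm} => [|m IH]; first by rewrite expr0 mulr1.
  by rewrite exprS mulrA (le_trans _ IH)// ler_wpM2r ?exprn_ge0// -ler_pdivlMr.
rewrite -(@ltr_pM2r _ (2 ^+ m)) ?exprn_gt0//.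
apply: (le_lt_trans rm); apply: (le_lt_trans rn).
rewrite mulrC ltr_pM2l// -natrX ltr_nat.
by rewrite (leq_ltn_trans nm)// ltn_expl.
Qed.

Lemma halving_cvg (X : normedModType K) (u : nat -> X) (l : X) :
  (forall n, `|l - u n| <= r n) -> u @ \oo --> l.
Proof.
move=> ur; apply/cvgrPdist_lt => e /halving_small[n rn].
by exists n => // m /= nm; exact: le_lt_trans (ur m) (rn m nm).
Qed.

Lemma halving_is_cvg (X : completeNormedModType K) (u : nat -> X) :
  (forall n, `|u n.+1 - u n| <= r n / 2) ->
  exists2 l, u @ \oo --> l & forall n, `|l - u n| <= r n.
Proof.
move=> ur.
(* The sharper bound [r n - r (n + k)] telescopes, since [r n / 2 <= r n - r n.+1]; a bare [r n]
   would not pass the induction. *)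
have ukn n k : `|u (n + k)%N - u n| <= r n - r (n + k)%N.
  elim: k => [|k IH]; first by rewrite addn0 !subrr normr0.
  rewrite addnS -(subrK (u (n + k)%N) (u _.+1)) -addrA.
  apply: (le_trans (ler_normD _ _)).
  apply: (le_trans (lerD (ur _) IH)).
  rewrite -subr_ge0.
  have -> : r n - r (n + k).+1 - (r (n + k)%N / 2 + (r n - r (n + k)%N)) =
    r (n + k)%N / 2 - r (n + k).+1 by field.
  by rewrite subr_ge0.
have unm n m : (n <= m)%N -> `|u m - u n| <= r n.
  move=> /subnKC <-; apply: (le_trans (ukn _ _)).
  by rewrite gerBl.
have /cvg_ex[l ul] : cvg (u @ \oo).
  apply: cauchy_cvg; apply: cauchy_exP => e /halving_small[n rn].
  exists (u n), n => // m /= nm; rewrite -ball_normE /ball_/= distrC.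
  exact: le_lt_trans (unm _ _ nm) (rn _ (leqnn n)).
exists l => // n; apply/ler_addgt0Pr => e e0.
have /cvgr_dist_lt/(_ e e0)[m _ um] := ul.
have := um (maxn n m) (leq_maxr _ _) => /ltW uml.
rewrite -(subrK (u (maxn n m)) l) -addrA addrC.
apply: (le_trans (ler_normD _ _)).
by rewrite lerD// unm// leq_maxl.
Qed.

End Halving.

(** * Baire category *)

Lemma pos_lower_bound (K : numFieldType) (e d : K) :
  0 < e -> 0 < d -> exists s, [/\ 0 < s, s <= e & s <= d].
Proof.
move=> e0 d0; have [ed|/ltW de] := real_leP (gtr0_real e0) (gtr0_real d0).
  by exists e.
by exists d.
Qed.

(** Otherwise every ball contains a smaller one missing a given [A n], and the centres of the
    resulting nested balls converge to a point outside every [A n]. Density in a ball is phrased by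
    approximation, without closures or interiors. *)
Lemma baire_cover (K : numFieldType) (hK : real_or_complex K)
    (X : completeNormedModType K) (A : nat -> set X) :
  (forall x, exists n, A n x) ->
  exists n a r, 0 < r /\ forall y, `|y - a| <= r -> forall e, 0 < e ->
    exists2 z, `|z - y| <= e & A n z.
Proof.
move=> Acover; apply: contrapT => Anowhere.
have step (p : nat * (X * K)) : exists q : X * K, 0 < p.2.2 ->
    [/\ 0 < q.2, q.2 <= p.2.2 / 2, `|q.1 - p.2.1| <= p.2.2 / 2 &
      forall z, `|z - q.1| <= q.2 -> ~ A p.1 z].
  case: p => n [a r] /=.
  have [r0|nr0] := pselect (0 < r); last by exists (a, r).
  apply: contrapT => nq; apply: Anowhere; exists n, a, (r / 2).
  split=> [|y ya e e0]; first exact: divr_gt0.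
  apply: contrapT => nz; apply: nq.
  (* [s <= e] makes the new ball miss [A n]; [s <= r / 2] halves the radius. *)
  have [s [s0 se sr]] := pos_lower_bound e0 (divr_gt0 r0 (ltr0Sn K 1)).
  exists (y, s) => _; split=> //= z zy Az; apply: nz; exists z => //.
  exact: le_trans zy se.
have [f fP] := choice step.
pose fix s n : X * K := if n is m.+1 then f (m, s m) else (0, 1).
have s0 n : 0 < (s n).2.
  by elim: n => [|n IH] /=; [exact: ltr01|case: (fP (n, s n) IH)].
have sP n := fP (n, s n) (s0 n).
have [] := @halving_is_cvg _ hK (fun n => (s n).2) _ _ X (fun n => (s n).1).
- by move=> n; exact/ltW/s0.
- by move=> n; case: (sP n).
- by move=> n; case: (sP n).
move=> l _ ls; have [n Anl] := Acover l.
by have [_ _ _ /(_ l (ls n.+1))] := sP n.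
Qed.

(** * The closed graph theorem *)

Section ClosedGraph.
Context {K : numFieldType} {X Y : completeNormedModType K}.
Variables (hK : real_or_complex K) (L : {linear X -> Y}).

(** By Baire, some set where [L] is bounded by [n] is dense in a ball of radius [r] about some [a].
    Rescaled differences of its points near [a + (r / d) *: x] and near [a] approximate [x]. *)
Lemma linear_nearly_bounded :
  exists2 M : K, 0 <= M & forall x (d : K), 0 < d -> `|x| <= d ->
    exists2 v, `|x - v| <= d / 2 & `|L v| <= M * d.
Proof.
have [x|n [a [r [r0 dense]]]] :=
    @baire_cover K hK X (fun n => [set x | `|L x| <= n%:R]).
  by have [n] := real_or_complex_archimedean hK (normr_ge0 (L x)); exists n.
exists (2 * n%:R / r) => [|x d d0 xd].
  by rewrite divr_ge0 ?mulr_ge0// ltW.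
(* Two errors of [r / 4], scaled by [d / r], add up to [d / 2]. *)
have r40 : 0 < r / 4 by rewrite divr_gt0.
have [|z1 z1P Lz1] := dense (a + (r / d) *: x) _ _ r40.
  rewrite addrC addKr normrZ gtr0_norm ?divr_gt0//.
  by rewrite mulrAC ler_pdivrMr// ler_wpM2l// ltW.
have [|z2 z2P Lz2] := dense a _ _ r40; first by rewrite subrr normr0 ltW.
have dr0 : 0 < d / r by rewrite divr_gt0.
exists ((d / r) *: (z1 - z2)).
  have -> : x - (d / r) *: (z1 - z2) =
      (d / r) *: ((z2 - a) - (z1 - (a + (r / d) *: x))).
    have {1}-> : x = (d / r) *: ((r / d) *: x).
      by rewrite scalerA mulrA divfK ?gt_eqF// divff ?gt_eqF// scale1r.
    rewrite -scalerBr; congr (_ *: _).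
    by rewrite !opprB [LHS]addrCA -(addrA a) [RHS]addrA subrK.
  rewrite normrZ gtr0_norm//.
  have -> : d / 2 = d / r * (r / 4 + r / 4) by field; rewrite gt_eqF.
  rewrite ler_wpM2l ?(ltW dr0)//.
  by apply: (le_trans (ler_normB _ _)); rewrite lerD.
rewrite linearZ linearB normrZ gtr0_norm//.
have -> : 2 * n%:R / r * d = d / r * (n%:R + n%:R) by field; rewrite gt_eqF.
rewrite ler_wpM2l ?(ltW dr0)//.
by apply: (le_trans (ler_normB _ _)); rewrite lerD.
Qed.

(** Repeated approximation gives remainders [u n] of norm at most [|x| / 2 ^ n], starting at [x],
    whose images converge to some [l] within [2 * M * |x|] of [L x]. As [u] tends to 0, the closed
    graph forces [l = 0]. *)
Theorem closed_graph :
  (forall (u : nat -> X) x y,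
    u @ \oo --> x -> L \o u @ \oo --> y -> L x = y) ->
  exists M : K, forall x, `|L x| <= M * `|x|.
Proof.
move=> graph_closed; have [M M0 approx] := linear_nearly_bounded.
exists (M * 2) => x; have [->|x0] := eqVneq x 0.
  by rewrite linear0 !normr0 mulr0.
pose d n : K := `|x| / 2 ^+ n.
have d0 n : 0 < d n by rewrite divr_gt0 ?normr_gt0 ?exprn_gt0.
have dS n : d n.+1 = d n / 2 by rewrite /d exprSr invfM mulrA.
have step (p : nat * X) : exists q, `|p.2| <= d p.1 ->
    `|q| <= d p.1.+1 /\ `|L q - L p.2| <= M * d p.1.
  case: p => n y /=; have [yd|] := pselect (`|y| <= d n); last by exists 0.
  have [v vP Lv] := approx y _ (d0 n) yd.
  by exists (y - v); rewrite dS linearB addrAC subrr sub0r normrN.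
have [f fP] := choice step.
pose fix u n := if n is m.+1 then f (m, u m) else x.
have ud n : `|u n| <= d n.
  by elim: n => [|n /(fP (n, _))[]//]; rewrite /d expr0 divr1.
have uL n := (fP (n, u n) (ud n)).2.
have u_cvg : u @ \oo --> (0 : X).
  apply: (@halving_cvg _ hK d) => n; rewrite ?dS ?sub0r ?normrN//.
  exact: ltW.
have [] := @halving_is_cvg _ hK (fun n => M * 2 * d n) _ _ Y (L \o u).
- by move=> n; rewrite !mulr_ge0// ltW.
- by move=> n; rewrite dS mulrA.
- move=> n; apply: (le_trans (uL n)).
  by rewrite mulrAC mulfK.
move=> l Lu /(_ 0%N); rewrite -(graph_closed _ _ _ u_cvg Lu) linear0 sub0r normrN.
by rewrite /d expr0 divr1.
Qed.

End ClosedGraph.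

(** * Bounded operators, projections and restricted inverses *)

Section BoundedOperators.
Context {K : numFieldType} {X : completeNormedModType K}.
Implicit Types (S T : X -> X) (M N : set X).

Lemma bounded_op_linear S : bounded_op S -> exists F : {linear X -> X}, S = F.
Proof.
case=> linS _.
by exists (HB.pack_for {linear X -> X} S (GRing.isLinear.Build _ _ _ _ _ linS)).
Qed.

(** The constant in [bounded_op] carries no sign condition: a nonzero vector forces it to be
    nonnegative, and on the zero space 1 serves. *)
Lemma bounded_op_pos S :
  bounded_op S -> exists2 B : K, 0 < B & forall x, `|S x| <= B * `|x|.
Proof.
case=> _ [B SB]; have [[x x0]|X0] := pselect (exists x : X, x != 0).
  have B0 : 0 <= B.
    rewrite -(@pmulr_lge0 _ `|x|) ?normr_gt0//.
    by rewrite (le_trans _ (SB x)).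
  exists (B + 1) => [|y]; first by rewrite ltr_wpDl.
  by rewrite (le_trans (SB y))// ler_wpM2r// lerDl.
have X00 (x : X) : x = 0.
  by apply: contrapT => /eqP x0; apply: X0; exists x.
by exists 1 => // x; rewrite (X00 (S x)) normr0 mul1r.
Qed.

Lemma bounded_op_comp S T : bounded_op S -> bounded_op T -> bounded_op (S \o T).
Proof.
move=> bS bT.
have [F FS] := bounded_op_linear bS; have [G GT] := bounded_op_linear bT.
have [B B0 SB] := bounded_op_pos bS; have [C _ TC] := bounded_op_pos bT.
split; first by move=> a x y /=; rewrite FS GT !linearP.
exists (B * C) => x /=; rewrite (le_trans (SB _))// -mulrA.
by rewrite ler_wpM2l// ltW.
Qed.

Lemma bounded_op_cvg S (u : nat -> X) x :
  bounded_op S -> u @ \oo --> x -> S \o u @ \oo --> S x.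
Proof.
move=> bS ux; have [F FS] := bounded_op_linear bS.
have [B B0 SB] := bounded_op_pos bS.
apply/cvgrPdist_lt => e e0.
have /cvgrPdist_lt/(_ (e / B) (divr_gt0 e0 B0))[n _ un] := ux.
exists n => // m /un um /=; rewrite FS -linearB -FS.
by rewrite (le_lt_trans (SB _))// mulrC -ltr_pdivlMr.
Qed.

Lemma closed_graph_bounded_op (hK : real_or_complex K) S :
  linear S ->
  (forall (u : nat -> X) x y,
    u @ \oo --> x -> S \o u @ \oo --> y -> S x = y) ->
  bounded_op S.
Proof.
move=> linS gS; split=> //.
exact: (@closed_graph _ _ _ hK (HB.pack_for {linear X -> X} S (GRing.isLinear.Build _ _ _ _ _ linS))).
Qed.

Lemma linear_subspaceB M x y : linear_subspace M -> M x -> M y -> M (x - y).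
Proof.
by move=> [M0 ML] Mx My; rewrite -scaleN1r addrC; apply: ML.
Qed.

Lemma bounded_projection (hK : real_or_complex K) M N :
  linear_subspace M -> closed M -> linear_subspace N -> closed N ->
  direct_sum M N ->
  exists P, [/\ bounded_op P, projection_onto_parallel M N P,
    forall x, M (P x) & forall x, N (x - P x)].
Proof.
move=> sM cM sN cN [MN_sum MN0].
have uniq x m m' : M m -> N (x - m) -> M m' -> N (x - m') -> m = m'.
  move=> Mm Nm Mm' Nm'; apply/eqP; rewrite -subr_eq0; apply/eqP.
  suff : (M `&` N) (m - m') by rewrite MN0.
  split; first exact: linear_subspaceB.
  have -> : m - m' = (x - m') - (x - m) by rewrite opprB [RHS]addrC addrA subrK.
  exact: linear_subspaceB.
have /choice[P PP] : forall x, exists p, M p /\ N (x - p).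
  move=> x; have [m [n [Mm Nn ->]]] := MN_sum x.
  by exists m; rewrite addrAC subrr add0r.
have MP x : M (P x) := (PP x).1.
have NP x : N (x - P x) := (PP x).2.
exists P; split=> //; last first.
  move=> m n Mm Nn; apply: (uniq (m + n)) => //.
  by rewrite addrAC subrr add0r.
apply: closed_graph_bounded_op => //.
  move=> a x y; apply: (uniq (a *: x + y)) => //; first exact: sM.2.
  by rewrite opprD addrACA -scalerBr; apply: sN.2.
(* Closed graph: the limit [y] lies in [M] and [x - y] in [N], so [y] is the [M]-component of
   [x]. *)
move=> u x y ux Py; apply: (uniq x) => //.
  by apply: closed_cvg Py => //; apply: nearW => n; apply: MP.
apply: (closed_cvg _ cN _ _ (cvgB ux Py)).
by apply: nearW => n; apply: NP.
Qed.

Lemma trivial_kernel_inj T M :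
  bounded_op T -> linear_subspace M -> op_kernel T `&` M = [set 0] ->
  forall w w', M w -> M w' -> T w = T w' -> w = w'.
Proof.
move=> bT sM kerT w w' Mw Mw' Tw; have [F FT] := bounded_op_linear bT.
apply/eqP; rewrite -subr_eq0; apply/eqP.
suff : (op_kernel T `&` M) (w - w') by rewrite kerT.
split; last exact: linear_subspaceB.
by rewrite /op_kernel /= FT linearB -FT Tw subrr.
Qed.

Lemma bounded_restricted_inverse (hK : real_or_complex K) T P M :
  bounded_op T -> bounded_op P -> linear_subspace M -> closed M ->
  op_kernel T `&` M = [set 0] ->
  (forall x, exists2 w, M w & T w = P x) ->
  exists2 W, bounded_op W & forall x, M (W x) /\ T (W x) = P x.
Proof.
move=> bT bP sM cM kerT TM.
have [F FT] := bounded_op_linear bT; have [G GP] := bounded_op_linear bP.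
have uniq := trivial_kernel_inj bT sM kerT.
have /choice[W WP] : forall x, exists w, M w /\ T w = P x.
  by move=> x; have [w] := TM x; exists w.
exists W => //; apply: closed_graph_bounded_op => //.
  move=> a x y; apply: uniq; first exact: (WP _).1.
    by apply: sM.2; apply: (WP _).1.
  by rewrite FT linearP -FT !(WP _).2 GP linearP.
move=> u x y ux Wy; apply: uniq; first exact: (WP _).1.
  by apply: closed_cvg Wy => //; apply: nearW => n; apply: (WP _).1.
(* [P \o u] equals [T \o (W \o u)], so it tends both to [P x] and to [T y]. *)
rewrite (WP _).2; apply: (@norm_cvg_unique _ X (P \o u @ \oo)).
  exact: bounded_op_cvg.
have -> : P \o u = T \o (W \o u) by apply/funext => n /=; rewrite (WP _).2.
exact: bounded_op_cvg.
Qed.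

End BoundedOperators.

(** * The analytic core *)

Section AnalyticCore.
Context {K : numFieldType} {X : completeNormedModType K}.
Variables (T : X -> X) (bT : bounded_op T).

(* The definition allows no constant in front of [c ^+ n * `|x 0|]: [B] is
   absorbed into the rate, and [x 0 = 0] forces the zero orbit. *)
Lemma analytic_coreI (x : nat -> X) (B c : K) :
  0 <= B -> 0 < c -> (forall n, T (x n.+1) = x n) ->
  (forall n, `|x n| <= B * c ^+ n) -> analytic_core T (x 0%N).
Proof.
move=> B0 c0 Tx xB; have [->|x0] := eqVneq (x 0%N) 0.
  exists (fun=> 0), 1; split=> // n _.
  by have [F ->] := bounded_op_linear bT; rewrite linear0 normr0 mulr0.
have nx0 : 0 < `|x 0%N| by rewrite normr_gt0.
exists x, (c * (B / `|x 0%N| + 1)); split=> //.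
  by rewrite mulr_gt0// ltr_wpDl// divr_ge0// ltW.
case=> // n _; split; first exact: Tx.
rewrite (le_trans (xB _))// exprMn -mulrA mulrC ler_wpM2l ?exprn_ge0 ?(ltW c0)//.
have B1 : 1 <= B / `|x 0%N| + 1 by rewrite lerDr divr_ge0// ltW.
rewrite -ler_pdivrMr// (@le_trans _ _ (B / `|x 0%N| + 1)) ?lerDl//.
by rewrite exprS ler_peMr ?exprn_ege1// (le_trans ler01).
Qed.

Lemma analytic_coreE x0 : analytic_core T x0 -> exists (x : nat -> X) (c : K),
  [/\ x 0%N = x0, 0 < c, forall n, T (x n.+1) = x n &
    forall n, `|x n| <= c ^+ n * `|x0|].
Proof.
move=> [x [c [x0E c0 xP]]]; exists x, c; split=> // n; first by case: (xP n.+1).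
case: n => [|n]; first by rewrite x0E expr0 mul1r.
by case: (xP n.+1).
Qed.

Lemma analytic_core_subspace : linear_subspace (analytic_core T).
Proof.
have [F FT] := bounded_op_linear bT.
split=> [|a _ _ /analytic_coreE[x [c [<- c0 Tx xc]]]
               /analytic_coreE[y [d [<- d0 Ty yd]]]].
  apply: (@analytic_coreI (fun=> 0) 0 1) => // n; first by rewrite FT linear0.
  by rewrite normr0 mul0r.
(* The rate [c + d] dominates both orbits. Cancellation may make the sum of the initial terms small,
   hence the separate constant. *)
apply: (@analytic_coreI (fun n => a *: x n + y n)
  (`|a| * `|x 0%N| + `|y 0%N|) (c + d)) => [|||n].
- by rewrite addr_ge0 ?mulr_ge0.
- exact: addr_gt0.
- by move=> n; rewrite FT linearP -FT Tx Ty.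
rewrite (le_trans (ler_normD _ _))// normrZ mulrDl -mulrA.
rewrite lerD ?ler_wpM2l//.
  rewrite (le_trans (xc n))// mulrC ler_wpM2l// lerXn2r ?nnegrE ?addr_ge0 ?ltW//.
  by rewrite ltrDl.
rewrite (le_trans (yd n))// mulrC ler_wpM2l// lerXn2r ?nnegrE ?addr_ge0 ?ltW//.
by rewrite ltrDr.
Qed.

Lemma analytic_core_hyperinvariant : hyperinvariant T (analytic_core T).
Proof.
move=> S bS ST _ [_ /analytic_coreE[x [c [<- c0 Tx xc]]] <-].
have [B B0 SB] := bounded_op_pos bS.
apply: (@analytic_coreI (S \o x) (B * `|x 0%N|) c) => // [|n|n /=].
- by rewrite mulr_ge0// ltW.
- by have /= <- := congr1 (@^~ (x n.+1)) ST; rewrite Tx.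
- by rewrite (le_trans (SB _))// -mulrA ler_wpM2l ?(ltW B0)// mulrC.
Qed.

Lemma analytic_core_surj x0 :
  analytic_core T x0 -> exists2 w, analytic_core T w & T w = x0.
Proof.
move=> /analytic_coreE[x [c [<- c0 Tx xc]]]; exists (x 1%N) => //.
apply: (@analytic_coreI (fun n => x n.+1) (c * `|x 0%N|) c) => // [|n].
  by rewrite mulr_ge0// ltW.
by rewrite (le_trans (xc _))// exprS mulrAC.
Qed.

Lemma Sigma2_range Q x : Sigma2 T Q -> analytic_core T (Q x).
Proof.
move=> [bQ QQ [_ [_ [S bS QS]]] [_ Qbicomm]].
have QT : Q \o T = T \o Q by apply: Qbicomm; split=> // _ ->.
have QQE y : Q (Q y) = Q y := congr1 (@^~ y) QQ.
have QTE y : Q (T y) = T (Q y) := congr1 (@^~ y) QT.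
have QSE y : T (Q (S y)) = Q y by rewrite [in RHS]QS /= QTE QQE.
have [B B0 QSB] := bounded_op_pos (bounded_op_comp bQ bS).
pose u n := iter n (Q \o S) (Q x).
(* The orbit stays in the range of [Q], where [T] undoes [Q \o S]. *)
have Qu n : Q (u n) = u n by case: n => [|n] /=; rewrite QQE.
apply: (@analytic_coreI u `|Q x| B) => // n; first by rewrite /= QSE Qu.
elim: n => [|n IH]; first by rewrite expr0 mulr1.
by rewrite (le_trans (QSB _))// exprS mulrCA ler_wpM2l// ltW.
Qed.

End AnalyticCore.

Theorem theorem6p5 (K : numFieldType) (hK : real_or_complex K)
    (X : completeNormedModType K) (T : X -> X) (hT : bounded_op T)
    (N : set X)
    (core_closed : closed (analytic_core T))
    (N_subspace : linear_subspace N)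
    (N_closed : closed N)
    (N_hyperinvariant : hyperinvariant T N)
    (core_N_sum : direct_sum (analytic_core T) N)
    (ker_core : op_kernel T `&` analytic_core T = [set 0]) :
  naturally_invertible T /\
  exists P : X -> X,
    projection_onto_parallel (analytic_core T) N P /\
    natural_greatest (Sigma2 T) P.
Proof.
have core_sub := analytic_core_subspace hT.
have [P [bP Pproj coreP NP]] := bounded_projection hK
  core_sub core_closed N_subspace N_closed core_N_sum.
suff Pgreatest : natural_greatest (Sigma2 T) P by split; exists P.
have Pid x : analytic_core T x -> P x = x.
  by move=> Kx; rewrite -{1}[x]addr0; apply: Pproj => //; exact: N_subspace.1.
have PP : P \o P = P by apply/funext => x /=; rewrite Pid.
have Pcomm S : bounded_op S -> S \o T = T \o S -> P \o S = S \o P.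
  move=> bS ST; apply/funext => x /=; have [F FS] := bounded_op_linear bS.
  (* Both summands are invariant under [S], so [S (P x) + S (x - P x)] is the decomposition of
     [S x]. *)
  rewrite -{1}[x](subrK (P x)) addrC FS linearD -FS; apply: Pproj.
    by apply: analytic_core_hyperinvariant ST _ _ => //; exists (P x).
  by apply: N_hyperinvariant ST _ _ => //; exists (x - P x).
have PT : P \o T = T \o P by exact: Pcomm.
have [W bW WP] : exists2 W, bounded_op W &
    forall x, analytic_core T (W x) /\ T (W x) = P x.
  apply: bounded_restricted_inverse => // x.
  exact: analytic_core_surj.
split.
  split=> //; last first.
    split=> // S [bS ST]; apply: Pcomm => //; exact: ST.
  split; split.
  - by exists (P \o T) => //; exact: bounded_op_comp.
  - by exists (T \o P) => //; exact: bounded_op_comp.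
  - exists W => //; apply/funext => x /=.
    (* [W] is a right inverse of [T] on the core; injectivity of [T] there makes it a left inverse
       too. *)
    have KT y : analytic_core T y -> W (T y) = y.
      move=> Ky; have [KW TW] := WP (T y).
      apply: (trivial_kernel_inj hT core_sub) => //.
      by rewrite TW -[P (T y)]/((P \o T) y) PT /= Pid.
    rewrite -[P (T (P x))]/((P \o T) (P x)) PT /= [P (P x)]Pid// KT//.
  - exists W => //; apply/funext => x /=.
    by have [KW TW] := WP x; rewrite [P (W x)]Pid// TW [RHS]Pid.
move=> Q SQ; have [bQ QQ _ [_ Qbicomm]] := SQ.
have PQ : P \o Q = Q by apply/funext => x; apply: Pid; exact: Sigma2_range.
(* The bicommutant property of [Q] applies to [P], which commutes with [T]. *)
split=> //; rewrite Qbicomm //; split=> // _ ->; exact: PT.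
Qed.
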